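(* Let $L\in R[x][\partial]$ have positive order and let $k\in\mathbb{N}$ be such that $M_k(L)$ contains a desingularized operator for $L$. Let $s$ be a nonzero element of the $k$th coefficient ideal $I_k$ of minimal degree in $x$. Then every operator $S\in M_k(L)$ with $\mathrm{lc}_\partial(S)=s$ is a desingularized operator for $L$.
   Context: $R$ is a principal ideal domain with quotient field $Q_R$. $\sigma$ is an $R$-automorphism of $R[x]$ with $\sigma(x)=\gamma x+\tau$ ($\gamma,\tau\in R$, $\gamma$ a unit), and $\delta$ is an $R$-linear $\sigma$-derivation of $R[x]$ with $\delta(x)\in R[x]$ of degree at most $1$. $R[x][\partial]$ is the Ore algebra with $\partial p=\sigma(p)\partial+\delta(p)$, contained in $Q_R(x)[\partial]$. Order $\deg_\partial$ and leading coefficient $\mathrm{lc}_\partial$ are with respect to $\partial$. $\mathrm{cont}(L)=Q_R(x)[\partial]L\cap R[x][\partial]$; $M_k(L)=\{P\in\mathrm{cont}(L):\deg_\partial P\le k\}$; the $k$th coefficient ideal is $I_k=\{[\partial^k]P: P\in M_k(L)\}\cup\{0\}\subseteq R[x]$, where $[\partial^k]P$ is the coefficient of $\partial^k$ in $P$. Removability: for $p\in R[x]$ dividing $\mathrm{lc}_\partial(L)$, $p$ is removable from $L$ at order $k$ if there are $P\in Q_R(x)[\partial]$ of order $k$ and $w,v\in R[x]$ with $\gcd(p,w)=1$ in $R[x]$ such that $PL\in R[x][\partial]$ and $\sigma^{-k}(\mathrm{lc}_\partial(PL))=\frac{w}{vp}\mathrm{lc}_\partial(L)$; removable means removable at some order,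 non-removable otherwise. Desingularized operator: if $L$ has order $r>0$ and $\mathrm{lc}_\partial(L)=c\,p_1^{e_1}\cdots p_m^{e_m}$ with $c\in R$, $p_i\in R[x]\setminus R$ irreducible and pairwise coprime, then $T\in R[x][\partial]$ of order $k$ is desingularized for $L$ if $T\in\mathrm{cont}(L)$ and $\sigma^{r-k}(\mathrm{lc}_\partial(T))=\frac{a}{b\,p_1^{k_1}\cdots p_m^{k_m}}\mathrm{lc}_\partial(L)$ for some $a,b\in R$, $b\neq 0$, nonnegative integers $k_i$ such that $p_i^{d_i}$ is non-removable from $L$ for all integers $d_i>k_i$. *)

(* Defs.v *)
From HB Require Import structures.
From mathcomp Require Import all_boot all_order all_algebra fraction generic_quotient.
Set Implicit Arguments. Unset Strict Implicit. Unset Printing Implicit Defensive.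
Import GRing.Theory.
Notation "x %:F" := (@FracField.tofrac _ x) : ring_scope.
Local Open Scope ring_scope.

Definition is_ideal (R : comNzRingType) (I : R -> Prop) :=
  I 0 /\ (forall x y, I x -> I y -> I (x - y)) /\ (forall a x, I x -> I (a * x)).

Definition PID (R : idomainType) : Prop :=
  forall I : R -> Prop, is_ideal I -> exists g : R, forall x, I x <-> exists c, x = c * g.

Definition dvdR (R : idomainType) (p q : {poly R}) : Prop := exists c, q = c * p.
Definition coprimeR (R : idomainType) (p w : {poly R}) : Prop :=
  forall dd, dvdR dd p -> dvdR dd w -> dd \is a GRing.unit.
Definition irredR (R : idomainType) (p : {poly R}) : Prop :=
  (1 < size p)%N /\ forall a b, p = a * b -> a \is a GRing.unit \/ b \is a GRing.unit.

Definition sigmaP (R : idomainType) (g t : R) (p : {poly R}) : {poly R} :=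
  p \Po (g *: 'X + t%:P).
Definition sigmaPinv (R : idomainType) (g t : R) (p : {poly R}) : {poly R} :=
  p \Po (g^-1 *: ('X - t%:P)).

(* Q_R(x) is represented as the fraction field of R[x] *)
Notation ratfun R := {fraction {poly R}}.

Definition numK (R : idomainType) (f : ratfun R) : {poly R} := (frac (repr f)).1.
Definition denK (R : idomainType) (f : ratfun R) : {poly R} := (frac (repr f)).2.

Definition sigmaK (R : idomainType) (g t : R) (f : ratfun R) : ratfun R :=
  (sigmaP g t (numK f))%:F / (sigmaP g t (denK f))%:F.
Definition sigmaKinv (R : idomainType) (g t : R) (f : ratfun R) : ratfun R :=
  (sigmaPinv g t (numK f))%:F / (sigmaPinv g t (denK f))%:F.
Definition sigmaZK (R : idomainType) (g t : R) (n : int) (f : ratfun R) : ratfun R :=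
  match n with
  | Posz m => iter m (sigmaK g t) f
  | Negz m => iter m.+1 (sigmaKinv g t) f
  end.
Definition deltaK (R : idomainType) (g t : R) (d : {poly R} -> {poly R})
    (f : ratfun R) : ratfun R :=
  let a := numK f in let b := denK f in
  (d a * sigmaP g t b - sigmaP g t a * d b)%:F / (sigmaP g t b * b)%:F.

Definition sigma_derivation (R : idomainType) (g t : R) (d : {poly R} -> {poly R}) : Prop :=
  (forall p q, d (p + q) = d p + d q) /\
  (forall (c : R) p, d (c *: p) = c *: d p) /\
  (forall p q, d (p * q) = sigmaP g t p * d q + d p * q) /\
  (size (d 'X) <= 2)%N.

(* ---------- Ore operators ----------
   An operator sum_i a_i D^i of Q_R(x)[D] is stored as the coefficient list
   {poly (ratfun R)} (only used as a container: the product below is the Ore product);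
   an operator of R[x][D] is stored as {poly {poly R}}. *)
Definition embedOp (R : idomainType) (T : {poly {poly R}}) : {poly ratfun R} :=
  map_poly (@FracField.tofrac _) T.

Definition dmul (R : idomainType) (g t : R) (d : {poly R} -> {poly R})
    (L : {poly ratfun R}) : {poly ratfun R} :=
  'X * map_poly (sigmaK g t) L + map_poly (deltaK g t d) L.

Definition ore_mul (R : idomainType) (g t : R) (d : {poly R} -> {poly R})
    (P L : {poly ratfun R}) : {poly ratfun R} :=
  \sum_(i < size P) P`_i *: iter i (dmul g t d) L.

Definition inCont (R : idomainType) (g t : R) (d : {poly R} -> {poly R})
    (L T : {poly {poly R}}) : Prop :=
  exists P : {poly ratfun R}, embedOp T = ore_mul g t d P (embedOp L).

Definition inM (R : idomainType) (g t : R) (d : {poly R} -> {poly R})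
    (k : nat) (L T : {poly {poly R}}) : Prop :=
  inCont g t d L T /\ (size T <= k.+1)%N.

Definition inI (R : idomainType) (g t : R) (d : {poly R} -> {poly R})
    (k : nat) (L : {poly {poly R}}) (s : {poly R}) : Prop :=
  s = 0 \/ exists T, inM g t d k L T /\ s = T`_k.

Definition removable_at (R : idomainType) (g t : R) (d : {poly R} -> {poly R})
    (p : {poly R}) (L : {poly {poly R}}) (k : nat) : Prop :=
  dvdR p (lead_coef L) /\
  exists (P : {poly ratfun R}) (w v : {poly R}),
    size P = k.+1 /\ v != 0 /\ coprimeR p w /\
    (forall i, exists q : {poly R}, (ore_mul g t d P (embedOp L))`_i = q%:F) /\
    sigmaZK g t (- (k%:Z)) (lead_coef (ore_mul g t d P (embedOp L)))
      = w%:F / (v * p)%:F * (lead_coef L)%:F.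

Definition removable (R : idomainType) (g t : R) (d : {poly R} -> {poly R})
    (p : {poly R}) (L : {poly {poly R}}) : Prop :=
  exists k, removable_at g t d p L k.

Definition desingularized (R : idomainType) (g t : R) (d : {poly R} -> {poly R})
    (L T : {poly {poly R}}) : Prop :=
  T != 0 /\ inCont g t d L T /\
  exists (m : nat) (c : R) (p : 'I_m -> {poly R}) (e : 'I_m -> nat),
    lead_coef L = c%:P * \prod_(i < m) p i ^+ e i /\
    (forall i, irredR (p i) /\ (0 < e i)%N) /\
    (forall i j, i != j -> coprimeR (p i) (p j)) /\
    exists (a b : R) (kk : 'I_m -> nat),
      b != 0 /\
      sigmaZK g t ((size L).-1%:Z - (size T).-1%:Z) (lead_coef T)%:F
        = (a%:P)%:F / (b%:P * \prod_(i < m) p i ^+ kk i)%:F * (lead_coef L)%:F /\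
      (forall i dd, (kk i < dd)%N -> ~ removable g t d (p i ^+ dd) L).

(* Main.v *)
Require Import Defs.
From HB Require Import structures.
From mathcomp Require Import all_boot all_order all_algebra fraction generic_quotient.
From mathcomp Require Import ring zify.
Import GRing.Theory Pdiv.Idomain.
Local Open Scope ring_scope.

(** Shifting to order k by powers of the generator turns T and S into elements
    t, s of I_k.  Since I_k is an ideal, pseudo-division of t by s and the
    minimality of deg s give c t = q s with c in R.  Hence sigma^(r-k)(s) divides
    a constant times lc(L), and as the p_i are prime in R[x] (Gauss's lemma) it is
    a constant times prod p_i^(h_i) with h_i <= e_i.  The operator S itself
    witnesses that p_i^(e_i - h_i) is removable, so e_i - h_i <= k_i, and then
    comparing with T forces equality. *)

(** * Arithmetic of R[x] over a principal ideal domain: contents and Gauss's lemma *)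

Section PolynomialsOverPID.
Set Implicit Arguments.
Unset Strict Implicit.

Variable R : idomainType.
Hypothesis pidR : PID R.
Implicit Types (a b c : R) (p q f h : {poly R}).

Definition primitive p := forall c, dvdR c%:P p -> c \is a GRing.unit.
Definition prime_elt p :=
  (1 < size p)%N /\ forall f h, dvdR p (f * h) -> dvdR p f \/ dvdR p h.

Lemma dvdR_trans p q f : dvdR p q -> dvdR q f -> dvdR p f.
Proof. by case=> u -> [v ->]; exists (v * u); rewrite mulrA. Qed.

Lemma dvdR_mull p q f : dvdR p q -> dvdR p (f * q).
Proof. by case=> u ->; exists (f * u); rewrite mulrA. Qed.

Lemma dvdR_sub p q f : dvdR p q -> dvdR p f -> dvdR p (q - f).
Proof. by case=> u -> [v ->]; exists (u - v); rewrite mulrBl. Qed.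

(** The quotients of the coefficients are only known to exist, so induction on the polynomial
    gathers them into one polynomial without a choice function. *)
Lemma dvdR_polyC c p : dvdR c%:P p <-> forall i, exists u, p`_i = u * c.
Proof.
split=> [[q ->] i | cp]; first by exists q`_i; rewrite coefMC.
suff [q Dq]: exists q, forall i, p`_i = q`_i * c.
  by exists q; apply/polyP=> i; rewrite coefMC.
elim/poly_ind: p cp => [|p a IHp] cp.
  by exists 0 => i; rewrite !coef0 mul0r.
have [i|q Dq] := IHp.
  by have [u] := cp i.+1; rewrite coefD coefMX coefC addr0 /=; exists u.
have [u] := cp 0%N; rewrite coefD coefMX coefC add0r /= => Du.
exists (q * 'X + u%:P) => -[|i]; rewrite !coefD !coefMX !coefC /= ?add0r //.
by rewrite !addr0.
Qed.

(** The r with c | b r form an ideal containing every coefficient of p. Its generator therefore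
    divides p, is a unit by primitivity, and so 1 lies in the ideal. *)
Lemma dvdR_polyC_mul c b p : primitive p -> dvdR c%:P (b%:P * p) ->
  exists u, b = u * c.
Proof.
move=> prim_p c_bp; pose J r := exists u, b * r = u * c.
have idJ : is_ideal J.
  split; first by exists 0; rewrite mulr0 mul0r.
  split=> [x y [u Du] [v Dv] | r x [u Du]].
    by exists (u - v); rewrite mulrBr Du Dv mulrBl.
  by exists (r * u); rewrite mulrCA Du mulrA.
have [e De] := pidR idJ.
have Ue : e \is a GRing.unit.
  apply: prim_p; apply/dvdR_polyC=> i.
  have [u Du] := (iffLR (dvdR_polyC c (b%:P * p)) c_bp) i.
  by apply/De; exists u; rewrite -coefCM.
have : J 1 by apply/De; exists e^-1; rewrite mulVr.
by case=> u; rewrite mulr1; exists u.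
Qed.

(** The content c generates the ideal of the coefficients, encoded as the intersection [I] of all
    ideals containing them. If e divides p/c, the coefficients lie in (e c), hence so does c, and e
    is a unit. *)
Lemma content_exists p : p != 0 -> exists c q, p = c%:P * q /\ primitive q.
Proof.
move=> nz_p.
pose I r := forall J : R -> Prop, is_ideal J -> (forall i, J p`_i) -> J r.
have idI : is_ideal I.
  split; first by move=> J [].
  split=> [x y Ix Iy | a x Ix] J idJ Jp; have [_ [JB JM]] := idJ.
    by apply: JB; [apply: Ix | apply: Iy].
  by apply: JM; apply: Ix.
have [c Dc] := pidR idI.
have [q Dp] : dvdR c%:P p.
  by apply/dvdR_polyC=> i; apply/Dc => J _; apply.
exists c, q; split=> [|e [f Df]]; first by rewrite mulrC.
pose J r := exists u, r = u * (e * c).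
have idJ : is_ideal J.
  split; first by exists 0; rewrite mul0r.
  split=> [x y [u ->] [v ->] | r x [u ->]]; first by exists (u - v); rewrite mulrBl.
  by exists (r * u); exact: mulrA.
have Ic : I c by apply/Dc; exists 1; rewrite mul1r.
have [i | u Du] := Ic J idJ.
  by exists f`_i; rewrite Dp Df -mulrA -polyCM coefMC.
have nz_c : c != 0 by apply: contraNneq nz_p => c0; rewrite Dp c0 mulr0.
apply/unitrPr; exists u; apply: (mulIf nz_c).
by rewrite mul1r [RHS]Du; ring.
Qed.

(** Bezout: the ideal generated by c and a is principal, and its generator is a common divisor,
    hence a unit. *)
Lemma coprime_dvd_mul c a b :
    (forall e u v, c = u * e -> a = v * e -> e \is a GRing.unit) ->
  (exists u, a * b = u * c) -> exists u, b = u * c.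
Proof.
move=> cop [u Du]; pose J r := exists v w, r = v * c + w * a.
have idJ : is_ideal J.
  split; first by exists 0, 0; rewrite !mul0r addr0.
  split=> [x y [v1 [w1 ->]] [v2 [w2 ->]] | r x [v [w ->]]].
    by exists (v1 - v2), (w1 - w2); ring.
  by exists (r * v), (r * w); ring.
have [e De] := pidR idJ.
have [v1 Dv1] : exists v, c = v * e by apply/De; exists 1, 0; ring.
have [v2 Dv2] : exists v, a = v * e by apply/De; exists 0, 1; ring.
have Ue := cop _ _ _ Dv1 Dv2.
have [v [w Dvw]] : J 1 by apply/De; exists e^-1; rewrite mulVr.
exists (v * b + w * u); rewrite mulrDl -[w * u * c]mulrA -Du.
by rewrite -[LHS]mul1r Dvw; ring.
Qed.

(* A common divisor e of c and lead_coef p divides p - lead_coef p X^n times q,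
   to which induction applies; hence c is coprime to both leading coefficients. *)
Lemma primitiveM p q : primitive p -> primitive q -> primitive (p * q).
Proof.
have [n] := ubnP (size p + size q); elim: n p q => // n IHn p q le_n prim_p prim_q.
(* Stated for arbitrary factors, with the induction hypothesis as a premise, so that it serves for
   both p q and q p. *)
have sym_half : forall f h, (size f + size h < n.+1)%N ->
    (forall f1, (size f1 + size h < n)%N -> primitive f1 -> primitive (f1 * h)) ->
    primitive f -> primitive h -> forall c, dvdR c%:P (f * h) ->
    forall e u v, c = u * e -> lead_coef f = v * e -> e \is a GRing.unit.
  move=> f h le_fh IH prim_f prim_h c c_fh e u v Dc Dv.
  have [f0 | nz_f] := eqVneq f 0.
    by apply: prim_f; exists 0; rewrite f0 mul0r.
  pose f' := f - (lead_coef f)%:P * 'X^((size f).-1).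
  have e_f' : dvdR e%:P (f' * h).
    rewrite mulrBl; apply: dvdR_sub.
      by apply: dvdR_trans c_fh; exists u%:P; rewrite -polyCM -Dc.
    by exists (v%:P * 'X^((size f).-1) * h); rewrite Dv polyCM; ring.
  apply: prim_f; rewrite (_ : f = f' + (lead_coef f)%:P * 'X^((size f).-1)); last first.
    by rewrite /f' subrK.
  suff e_f'' : dvdR e%:P f'.
    case: e_f'' => w ->; exists (w + v%:P * 'X^((size f).-1)).
    by rewrite Dv polyCM; ring.
  have [-> | nz_f'] := eqVneq f' 0; first by exists 0; rewrite mul0r.
  (* [f'] need not be primitive, so induction is applied to its primitive part [f1], which has the
     same size; e then divides the content b. *)
  have [b [f1 [Df' prim_f1]]] := content_exists nz_f'.
  have nz_b : b != 0 by apply: contraNneq nz_f' => b0; rewrite Df' b0 mul0r.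
  have sz_f1 : size f1 = size f' by rewrite Df' size_Cmul.
  have lt_f' : (size f' < size f)%N.
    rewrite -[X in (_ < X)%N](ltn_predK (m := 0)) ?size_poly_gt0 // ltnS.
    apply/leq_sizeP=> j; rewrite leq_eqVlt => /predU1P[<- | lt_j].
      by rewrite coefB coefCM coefXn eqxx mulr1 subrr.
    rewrite coefB coefCM coefXn gtn_eqF // mulr0 subr0.
    by apply: nth_default; rewrite -(ltn_predK (m := 0) (n := size f)) ?size_poly_gt0.
  have [] := @dvdR_polyC_mul e b (f1 * h).
  - by apply: IH => //; rewrite sz_f1; lia.
  - by rewrite mulrA -Df'.
  by move=> w Dw; rewrite Df' Dw polyCM; exists (w%:P * f1); ring.
move=> c c_pq.
have cop_p := sym_half p q le_n (fun f1 l1 pf => IHn f1 q l1 pf prim_q) prim_p prim_q c c_pq.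
have cop_q : forall e u v, c = u * e -> lead_coef q = v * e -> e \is a GRing.unit.
  apply: (sym_half q p) => //; first by rewrite addnC.
    move=> f1 l1 pf; rewrite mulrC; apply: IHn => //; first by rewrite addnC.
  by rewrite mulrC.
have [u Du] : exists u, lead_coef p * lead_coef q = u * c.
  by case: c_pq => w Dw; exists (lead_coef w); rewrite -lead_coefM Dw lead_coefM lead_coefC.
have [w Dw] := coprime_dvd_mul cop_p (ex_intro _ u Du).
(* Now c divides [lead_coef q] while coprime to it, so c is a unit. *)
by apply: (cop_q c 1 w) => //; rewrite mul1r.
Qed.

(** Divisibility over Q_R descends to R[x]: with q = b q1 and q1 primitive, Gauss's lemma makes q1 p
    primitive, so c divides b and can be cancelled. *)
Lemma primitive_dvdR c p q f : c != 0 -> primitive p ->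
  c%:P * f = q * p -> dvdR p f.
Proof.
move=> nz_c prim_p Df.
have [-> | nz_f] := eqVneq f 0; first by exists 0; rewrite mul0r.
have nz_q : q != 0.
  apply: contraNneq nz_f => q0; move/eqP: Df.
  by rewrite q0 mul0r mulf_eq0 polyC_eq0 (negPf nz_c).
have [b [q1 [Dq prim_q1]]] := content_exists nz_q.
have [|u Du] := @dvdR_polyC_mul c b (q1 * p) (primitiveM prim_q1 prim_p).
  by exists f; rewrite mulrA -Dq -Df mulrC.
exists (u%:P * q1); apply: (@mulfI _ c%:P); first by rewrite polyC_eq0.
by rewrite Df Dq Du polyCM; ring.
Qed.

(** Let m be the primitive part of the gcd of p and a over Q_R; it divides both in R[x]. By
    irreducibility either m is associate to p, so p | a, or m is a unit, so p and a are coprime over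
    Q_R and p | b there, hence in R[x]. *)
Lemma irredR_prime p : irredR p -> prime_elt p.
Proof.
case=> sz_p irr_p; split=> // a b [r Dr].
have nz_p : p != 0 by rewrite -size_poly_gt0; lia.
have unitC (x : R) : x%:P \is a GRing.unit -> x \is a GRing.unit.
  by rewrite poly_unitE coefC => /andP[].
have prim_p : primitive p.
  move=> c [q Dq]; have [] := irr_p _ _ Dq; last exact: unitC.
  rewrite poly_unitE => /andP[/eqP sz_q _].
  move: sz_p; rewrite Dq; have := size_polyMleq q c%:P; rewrite sz_q.
  have := size_polyC_leq1 c; lia.
have nz_m : gcdp p a != 0 by rewrite gcdp_eq0 negb_and nz_p.
have [c [m [Dm prim_m]]] := content_exists nz_m.
have [[e q] /= nz_e Deq] := Pdiv.Idomain.dvdpP _ _ (dvdp_gcdl p a).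
have [[e' q'] /= nz_e' Deq'] := Pdiv.Idomain.dvdpP _ _ (dvdp_gcdr p a).
have nz_c : c != 0 by apply: contraNneq nz_m => c0; rewrite Dm c0 mul0r.
have [u Du] : dvdR m p.
  by apply: (primitive_dvdR (q := q * c%:P) nz_e prim_m); rewrite mul_polyC Deq Dm mulrA.
have m_a : dvdR m a.
  by apply: (primitive_dvdR (q := q' * c%:P) nz_e' prim_m); rewrite mul_polyC Deq' Dm mulrA.
have [Uu | Um] := irr_p _ _ Du.
  by left; apply: dvdR_trans m_a; exists u^-1; rewrite Du mulrA mulVr ?mul1r.
right; have cop : coprimep p a.
  rewrite /coprimep Dm size_Cmul //.
  by move: Um; rewrite poly_unitE => /andP[].
have p_ab : p %| a * b by rewrite Dr dvdp_mull.
move: p_ab; rewrite Gauss_dvdpr // => /Pdiv.Idomain.dvdpP[[e1 q1] /= nz_e1 De1].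
by apply: (primitive_dvdR (q := q1) nz_e1 prim_p); rewrite mul_polyC.
Qed.

(** * Products of powers of prime elements and their divisors *)

Lemma prime_elt_neq0 p : prime_elt p -> p != 0.
Proof. by case=> sz_p _; rewrite -size_poly_gt0; lia. Qed.

Lemma polyC_eq_mul c p q : c != 0 -> c%:P = p * q -> size p = 1%N /\ size q = 1%N.
Proof.
move=> nz_c Dc.
have : p * q != 0 by rewrite -Dc polyC_eq0.
rewrite mulf_eq0 negb_or => /andP[nz_p nz_q].
have := congr1 (size : {poly R} -> nat) Dc; rewrite size_polyC nz_c size_mul //.
by move: nz_p nz_q; rewrite -!size_poly_gt0 /=; lia.
Qed.

Lemma prime_eltN_polyC p c : prime_elt p -> c != 0 -> ~ dvdR p c%:P.
Proof. by case=> sz_p _ nz_c [q /(polyC_eq_mul nz_c)[_ p1]]; rewrite p1 in sz_p. Qed.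

(** If p^(n+1) = r q with q | f, the prime p divides r, since p | q would give p | f. Cancelling p
    lowers the exponent until q divides 1. *)
Lemma coprimeR_prime_exp p f n : prime_elt p -> ~ dvdR p f -> coprimeR (p ^+ n) f.
Proof.
move=> prim_p ndv q; elim: n => [|n IHn] [r Dr] q_f.
  by apply/unitrPr; exists r; rewrite mulrC -Dr expr0.
have [| [u Du] | p_q] := prim_p.2 r q.
- by exists (p ^+ n); rewrite -Dr exprSr.
- apply: IHn q_f; exists u; apply: (mulIf (prime_elt_neq0 prim_p)).
  by rewrite -exprSr Dr Du mulrAC.
by case: ndv; apply: dvdR_trans q_f.
Qed.

Lemma prod_exp_incr m (p : 'I_m -> {poly R}) (e : 'I_m -> nat) i :
  \prod_(j < m) p j ^+ ((j == i) + e j)%N = p i * \prod_(j < m) p j ^+ e j.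
Proof.
under eq_bigr do rewrite exprD.
by rewrite big_split /= (bigD1 i) //= eqxx big1 ?mulr1 // => j /negPf->.
Qed.

Lemma prod_prime_exp_neq0 m (p : 'I_m -> {poly R}) (e : 'I_m -> nat) :
  (forall i, prime_elt (p i)) -> \prod_(i < m) p i ^+ e i != 0.
Proof.
by move=> prim_p; apply/prodf_neq0 => i _; rewrite expf_neq0 ?prime_elt_neq0.
Qed.

(** Induction on the sum of the exponents: each step cancels one prime p_i from whichever of f, h it
    divides. *)
Lemma factor_prod_prime m (p : 'I_m -> {poly R}) (e : 'I_m -> nat) c f h :
    (forall i, prime_elt (p i)) -> c != 0 ->
    c%:P * \prod_(i < m) p i ^+ e i = f * h ->
  exists b (n : 'I_m -> nat),
    h = b%:P * \prod_(i < m) p i ^+ n i /\ forall i, (n i <= e i)%N.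
Proof.
move=> prim_p nz_c.
have [n] := ubnP (\sum_(i < m) e i)%N; elim: n e f h => // n IHn e f h lt_n Dfh.
have [i e_i | e0] := pickP (fun i => 0 < e i)%N; last first.
  have e0' i : e i = 0%N by move: (e0 i); case: (e i).
  (* With all exponents 0, f h is a nonzero constant, so h is constant. *)
  exists h`_0, (fun=> 0%N); split=> //; rewrite big1 // mulr1; apply: size1_polyC.
  move: Dfh; rewrite big1 => [|i _]; last by rewrite e0' expr0.
  rewrite mulr1 => Dc.
  by have [_ ->] := polyC_eq_mul nz_c Dc.
pose e' j := (e j - (j == i))%N.
have De j : e j = ((j == i) + e' j)%N.
  by rewrite /e'; case: eqP => [->|_] /=; lia.
have lt_e' : (\sum_(i < m) e' i < n)%N.
  move: lt_n; under eq_bigr do rewrite De.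
  by rewrite big_split /= (bigD1 i) //= eqxx; lia.
have Dprod : \prod_(j < m) p j ^+ e j = p i * \prod_(j < m) p j ^+ e' j.
  by rewrite -prod_exp_incr; apply: eq_bigr => j _; rewrite De.
have [|[f' Df]|[h' Dh]] := (prim_p i).2 f h.
- by rewrite -Dfh Dprod mulrCA; exists (c%:P * \prod_(j < m) p j ^+ e' j); rewrite mulrC.
- have [|b [k [Dh le_k]]] := IHn e' f' h lt_e'.
    apply: (mulfI (prime_elt_neq0 (prim_p i))).
    by rewrite mulrCA -Dprod Dfh Df; ring.
  by exists b, k; split=> // j; rewrite De (leq_trans (le_k j)) ?leq_addl.
have [|b [k [Dh' le_k]]] := IHn e' f h' lt_e'.
  apply: (mulfI (prime_elt_neq0 (prim_p i))).
  by rewrite mulrCA -Dprod Dfh Dh; ring.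
exists b, (fun j => (j == i) + k j)%N; split=> [|j]; last by rewrite De leq_add2l.
by rewrite prod_exp_incr Dh Dh'; ring.
Qed.

(** Cancelling the p_i^(e_i) writes the constant c as a multiple of the excess powers p_i^(r_i). A
    prime of positive degree cannot divide a nonzero constant, so every excess vanishes. *)
Lemma prod_prime_exp_eq m (p : 'I_m -> {poly R}) (e n k : 'I_m -> nat) c b f :
    (forall i, prime_elt (p i)) -> c != 0 ->
    c%:P * \prod_(i < m) p i ^+ e i =
      \prod_(i < m) p i ^+ k i * f * (b%:P * \prod_(i < m) p i ^+ n i) ->
    (forall i, e i <= k i + n i)%N ->
  forall i, e i = (k i + n i)%N.
Proof.
move=> prim_p nz_c Dc le_e i; apply/eqP; rewrite eqn_leq le_e leqNgt; apply/negP => lt_i.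
pose r j := (k j + n j - e j)%N.
have Dprod : \prod_(i < m) p i ^+ k i * \prod_(i < m) p i ^+ n i =
    \prod_(i < m) p i ^+ e i * \prod_(i < m) p i ^+ r i.
  rewrite -!big_split /=; apply: eq_bigr => j _.
  by rewrite -!exprD /r subnKC.
have Dc' : c%:P = f * b%:P * \prod_(i < m) p i ^+ r i.
  apply: (mulfI (prod_prime_exp_neq0 e prim_p)); rewrite mulrC Dc mulrACA.
  by rewrite [X in _ = X]mulrCA -Dprod; ring.
apply: (prime_eltN_polyC (prim_p i) nz_c); rewrite Dc'; apply: dvdR_mull.
rewrite (bigD1 i) //= -(subnK (m := 1) (n := r i)) ?subn_gt0 // addn1 exprSr.
by exists (p i ^+ (r i - 1) * \prod_(j < m | j != i) p j ^+ r j); rewrite mulrAC.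
Qed.

End PolynomialsOverPID.

(** * Field identities behind the rules for sigma-derivations of fractions *)

Section FieldIdentities.

Variable F : fieldType.

(** Read n/e = a/b, with prefixes s and d for the images under sigma and delta. The premises are
    sigma and delta applied to n b = a e, and the two expansions of delta(b e) = delta(e b), which
    the twisted Leibniz rule makes a genuine relation. *)
Lemma quotient_rule (e b sn se sa sb dn de da db : F) : e != 0 -> se != 0 -> sb != 0 ->
    sn * sb = sa * se -> sn * db + dn * b = sa * de + da * e ->
    sb * de + db * e = se * db + de * b ->
  sn / se * db + (dn * se - sn * de) / (se * e) * b = da.
Proof.
move=> nz_e nz_se nz_sb Es Ed Ec.
apply: (mulIf (x := se * e * sb)); first by rewrite !mulf_neq0.
have -> : (sn / se * db + (dn * se - sn * de) / (se * e) * b) * (se * e * sb)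
  = (sn * db + dn * b) * se * sb + sn * sb * (db * e - se * db - de * b).
  by field; rewrite nz_se nz_e.
rewrite Ed Es (_ : db * e = se * db + de * b - sb * de); last by rewrite -Ec; ring.
by ring.
Qed.

(** Here b is a common denominator of f and h; the two premises equate two expansions of delta(h
    b^2) and of delta(f h b^2). *)
Lemma product_rule (sf sh df dh dfh f h sb db b : F) : b != 0 ->
    sh * (sb * db + db * b) + dh * (b * b) = sb * (sh * db + dh * b) + db * (h * b) ->
    sf * sh * (sb * db + db * b) + dfh * (b * b) =
      (sf * sb) * (sh * db + dh * b) + (sf * db + df * b) * (h * b) ->
  dfh = sf * dh + df * h.
Proof.
move=> nz_b E1 E2; apply: (mulIf (x := b * b)); first by rewrite mulf_neq0.
apply: (addrI (sf * sh * (sb * db + db * b))); rewrite E2.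
have -> : sf * sh * (sb * db + db * b) + (sf * dh + df * h) * (b * b) =
  sf * (sh * (sb * db + db * b) + dh * (b * b)) + df * h * (b * b) by ring.
by rewrite E1; ring.
Qed.

End FieldIdentities.

(** * Extension of sigma and delta from R[x] to its fraction field *)

Section OreOperators.
Set Implicit Arguments.
Unset Strict Implicit.

Variables (R : idomainType) (g t : R) (d : {poly R} -> {poly R}).
Hypotheses (Ug : g \is a GRing.unit) (der_d : sigma_derivation g t d).
Local Notation K := (ratfun R).
Local Notation sg := (sigmaP g t).
Local Notation sgi := (sigmaPinv g t).
Local Notation sgK := (sigmaK g t).
Local Notation dK := (deltaK g t d).
Local Notation omul := (ore_mul g t d).
Local Notation dm := (dmul g t d).
Implicit Types (a b p q : {poly R}) (f h : K) (M P : {poly K}) (T L : {poly {poly R}}).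

Lemma sigmaPM p q : sg (p * q) = sg p * sg q.
Proof. exact: comp_polyM. Qed.

Lemma sigmaPD p q : sg (p + q) = sg p + sg q.
Proof. exact: comp_polyD. Qed.

Lemma sigmaP1 : sg 1 = 1.
Proof. by rewrite /sigmaP -polyC1 comp_polyC. Qed.

Lemma sigmaPK : cancel sg sgi.
Proof.
move=> p; rewrite /sigmaP /sigmaPinv -comp_polyA comp_polyD comp_polyZ comp_polyX comp_polyC.
by rewrite scalerA mulrV // scale1r subrK comp_polyXr.
Qed.

Lemma size_linear (c e : R) : c != 0 -> size (c *: 'X + e%:P) = 2%N.
Proof. by move=> nz_c; rewrite -mul_polyC size_MXaddC polyC_eq0 size_polyC (negPf nz_c). Qed.

Lemma size_sigmaP p : size (sg p) = size p.
Proof.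
by apply: size_comp_poly2; apply: size_linear; apply: contraTneq Ug => ->; rewrite unitr0.
Qed.

Lemma size_sigmaPinv p : size (sgi p) = size p.
Proof.
apply: size_comp_poly2; rewrite scalerBr -[g^-1 *: t%:P]mul_polyC -polyCM -polyCN.
by apply: size_linear; apply: contraTneq Ug => Vg0; rewrite -unitrV Vg0 unitr0.
Qed.

Lemma iter_sigmaPinv_eq0 n p : (iter n sgi p == 0) = (p == 0).
Proof. by elim: n => //= n <-; rewrite -!size_poly_eq0 size_sigmaPinv. Qed.

Lemma sigmaP_eq0 p : (sg p == 0) = (p == 0).
Proof. by rewrite -!size_poly_eq0 size_sigmaP. Qed.

Lemma sigmaPinvM p q : sgi (p * q) = sgi p * sgi q.
Proof. exact: comp_polyM. Qed.

Lemma iter_sigmaPinvM n p q : iter n sgi (p * q) = iter n sgi p * iter n sgi q.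
Proof. by elim: n => //= n ->; rewrite sigmaPinvM. Qed.

Lemma iter_sigmaPinvC n (c : R) : iter n sgi c%:P = c%:P.
Proof. by elim: n => //= n ->; rewrite /sigmaPinv comp_polyC. Qed.

Lemma derivationD p q : d (p + q) = d p + d q.
Proof. exact: der_d.1. Qed.

Lemma derivationM p q : d (p * q) = sg p * d q + d p * q.
Proof. exact: der_d.2.2.1. Qed.

Lemma denK_neq0 f : denK f != 0.
Proof. exact: denom_ratioP. Qed.

Lemma numK_denK f : f * (denK f)%:F = (numK f)%:F.
Proof.
have nz1 : 1 != 0 :> {poly R} := oner_neq0 _.
rewrite /numK /denK -[in LHS](reprK f); set r := repr f.
unlock FracField.tofrac; rewrite -[LHS]FracField.pi_mul; apply/eqmodP => /=.
rewrite FracField.equivfE /FracField.mulf !numden_Ratio ?mulf_neq0 ?denom_ratioP //.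
by rewrite !mulr1 reprK mulrC.
Qed.

Lemma tofrac_neq0 q : q != 0 -> q%:F != 0 :> K.
Proof. by rewrite tofrac_eq0. Qed.

(** Frees [sigmaK] from the representative chosen in its definition: any presentation a/b of f
    computes it. The additive and multiplicative laws follow by taking common denominators. *)
Lemma sigmaK_eq f a b : b != 0 -> f * b%:F = a%:F -> sgK f * (sg b)%:F = (sg a)%:F.
Proof.
move=> nz_b fb; have nz_e := denK_neq0 f.
have /eqP : (numK f * b)%:F = (a * denK f)%:F :> K.
  by rewrite !tofracM -fb -numK_denK mulrAC.
rewrite tofrac_eq => /eqP /(congr1 sg); rewrite !sigmaPM => E.
apply: (mulIf (x := (sg (denK f))%:F)); first by rewrite tofrac_neq0 ?sigmaP_eq0.
rewrite -[RHS]tofracM -E tofracM /sigmaK mulrAC divfK ?tofrac_neq0 ?sigmaP_eq0 //.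
Qed.

(** The analogue for [deltaK]: the Leibniz rule for f b = a, whatever the presentation of f. *)
Lemma deltaK_eq f a b : b != 0 -> f * b%:F = a%:F ->
  sgK f * (d b)%:F + dK f * b%:F = (d a)%:F.
Proof.
move=> nz_b fb; have nz_e := denK_neq0 f.
have nz_sb : sg b != 0 by rewrite sigmaP_eq0.
have nz_se : sg (denK f) != 0 by rewrite sigmaP_eq0.
have /eqP : (numK f * b)%:F = (a * denK f)%:F :> K.
  by rewrite !tofracM -fb -numK_denK mulrAC.
rewrite tofrac_eq /deltaK /sigmaK; move: (numK f) (denK f) nz_e nz_se => n e nz_e nz_se /eqP E.
have Es : sg n * sg b = sg a * sg e by rewrite -!sigmaPM E.
have Ed : sg n * d b + d n * b = sg a * d e + d a * e by rewrite -!derivationM E.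
have Ec : sg b * d e + d b * e = sg e * d b + d e * b.
  by rewrite -!derivationM mulrC.
have tf (u v : {poly R}) : u = v -> u%:F = v%:F :> K by move->.
move: (tf _ _ Es) (tf _ _ Ed) (tf _ _ Ec); rewrite !(tofracB, tofracD, tofracM).
by apply: quotient_rule; rewrite tofrac_neq0.
Qed.

Lemma common_denK f h :
  exists a b c, [/\ b != 0, f * b%:F = a%:F & h * b%:F = c%:F].
Proof.
exists (numK f * denK h), (denK f * denK h), (numK h * denK f).
split; first by rewrite mulf_neq0 ?denK_neq0.
  by rewrite !tofracM -numK_denK mulrA.
by rewrite !tofracM -numK_denK mulrCA mulrC.
Qed.

Lemma sigmaKD f h : sgK (f + h) = sgK f + sgK h.
Proof.
have [a [b [c [nz_b fb hb]]]] := common_denK f h.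
apply: (mulIf (x := (sg b)%:F)); first by rewrite tofrac_neq0 ?sigmaP_eq0.
rewrite (sigmaK_eq (a := a + c)) //; last by rewrite mulrDl fb hb tofracD.
by rewrite mulrDl (sigmaK_eq nz_b fb) (sigmaK_eq nz_b hb) sigmaPD tofracD.
Qed.

Lemma sigmaKM f h : sgK (f * h) = sgK f * sgK h.
Proof.
have [a [b [c [nz_b fb hb]]]] := common_denK f h.
apply: (mulIf (x := (sg (b * b))%:F)); first by rewrite tofrac_neq0 ?sigmaP_eq0 ?mulf_neq0.
rewrite (sigmaK_eq (a := a * c)) ?mulf_neq0 //; last by rewrite !tofracM -fb -hb mulrACA.
by rewrite !sigmaPM !tofracM -(sigmaK_eq nz_b fb) -(sigmaK_eq nz_b hb) mulrACA.
Qed.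

Lemma sigmaK_tofrac p : sgK p%:F = (sg p)%:F.
Proof.
have := @sigmaK_eq p%:F p 1 (oner_neq0 _).
by rewrite sigmaP1 tofrac1 !mulr1; apply.
Qed.

Lemma sigmaK0 : sgK 0 = 0.
Proof. by rewrite -tofrac0 sigmaK_tofrac /sigmaP comp_poly0. Qed.

Lemma sigmaK_eq0 f : (sgK f == 0) = (f == 0).
Proof.
apply/eqP/eqP=> [sf0|->]; last exact: sigmaK0.
have := sigmaK_eq (denK_neq0 f) (numK_denK f).
rewrite sf0 mul0r => /esym/eqP; rewrite tofrac_eq0 sigmaP_eq0 => /eqP n0.
have /eqP := numK_denK f; rewrite n0 tofrac0 mulf_eq0 tofrac_eq0 (negPf (denK_neq0 f)) orbF.
by move/eqP.
Qed.

Lemma deltaKD f h : dK (f + h) = dK f + dK h.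
Proof.
have [a [b [c [nz_b fb hb]]]] := common_denK f h.
apply: (mulIf (x := b%:F)); first by rewrite tofrac_neq0.
have fhb : (f + h) * b%:F = (a + c)%:F by rewrite mulrDl fb hb tofracD.
have := deltaK_eq nz_b fhb; rewrite derivationD tofracD.
rewrite -(deltaK_eq nz_b fb) -(deltaK_eq nz_b hb) sigmaKD => E.
apply: (addrI (sgK f * (d b)%:F + sgK h * (d b)%:F)).
by rewrite -mulrDl E !mulrDl addrACA.
Qed.

Lemma deltaKM f h : dK (f * h) = sgK f * dK h + dK f * h.
Proof.
have [a [b [c [nz_b fb hb]]]] := common_denK f h.
have nz_bb : b * b != 0 by rewrite mulf_neq0.
have fhb : (f * h) * (b * b)%:F = (a * c)%:F by rewrite !tofracM -fb -hb mulrACA.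
have hbb : h * (b * b)%:F = (b * c)%:F by rewrite !tofracM -hb mulrCA.
have := deltaK_eq nz_bb fhb; have := deltaK_eq nz_bb hbb.
rewrite !derivationM !(tofracD, tofracM) sigmaKM.
rewrite -(deltaK_eq nz_b fb) -(deltaK_eq nz_b hb) -(sigmaK_eq nz_b fb) -hb.
move=> E1 E2; exact: (@product_rule K _ _ _ _ _ _ _ _ _ _ (tofrac_neq0 nz_b) E1 E2).
Qed.

Lemma derivation1 : d 1 = 0.
Proof.
apply: (addrI (d 1)); rewrite addr0 -[in RHS](mulr1 1) derivationM.
by rewrite sigmaP1 mul1r mulr1.
Qed.

Lemma deltaK_tofrac p : dK p%:F = (d p)%:F.
Proof.
have := @deltaK_eq p%:F p 1 (oner_neq0 _).
by rewrite derivation1 tofrac0 tofrac1 mulr0 add0r !mulr1; apply.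
Qed.

Lemma deltaK0 : dK 0 = 0.
Proof. by apply: (addrI (dK 0)); rewrite -deltaKD !addr0. Qed.

Lemma sigmaKinv_tofrac p : sigmaKinv g t p%:F = (sgi p)%:F.
Proof.
rewrite /sigmaKinv; have nz_e := denK_neq0 p%:F; have := numK_denK p%:F.
rewrite -tofracM => /eqP; rewrite tofrac_eq => /eqP <-; rewrite sigmaPinvM tofracM mulfK //.
by rewrite tofrac_neq0 // -size_poly_eq0 size_sigmaPinv size_poly_eq0.
Qed.

Lemma sigmaZK_opp_tofrac n p : sigmaZK g t (- n%:Z) p%:F = (iter n sgi p)%:F.
Proof.
case: n => // n; rewrite -NegzE /=.
have E m : iter m (sigmaKinv g t) p%:F = (iter m sgi p)%:F.
  by elim: m => //= m ->; rewrite sigmaKinv_tofrac.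
by rewrite E sigmaKinv_tofrac.
Qed.

(** * Left multiplication by the Ore variable and the Ore product *)

Lemma coef_dmul M i : (dm M)`_i = (if i == 0%N then 0 else sgK M`_i.-1) + dK M`_i.
Proof.
rewrite /dmul coefD coefXM (coef_map_id0 _ _ deltaK0).
by case: i => //= i; rewrite (coef_map_id0 _ _ sigmaK0).
Qed.

Lemma dmulD M P : dm (M + P) = dm M + dm P.
Proof.
apply/polyP=> i; rewrite coefD !coef_dmul !coefD deltaKD.
by case: i => [|i] /=; rewrite ?add0r // sigmaKD addrACA.
Qed.

Lemma dmul0 : dm 0 = 0.
Proof. by apply: (addrI (dm 0)); rewrite -dmulD !addr0. Qed.

Lemma dmulZ f M : dm (f *: M) = sgK f *: dm M + dK f *: M.
Proof.
apply/polyP=> i; rewrite [RHS]coefD [in RHS]coefZ [X in _ = _ + X]coefZ.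
rewrite !coef_dmul !coefZ deltaKM mulrDr -addrA.
by congr (_ + _); case: i => [|i] /=; rewrite ?mulr0 // sigmaKM.
Qed.

(** The delta part does not raise the order, and the new top coefficient is sigma of the old one,
    nonzero because sigma is injective. *)
Lemma size_dmul M : M != 0 -> size (dm M) = (size M).+1.
Proof.
move=> nz_M; have sz_M : (0 < size M)%N by rewrite size_poly_gt0.
apply/eqP; rewrite eqn_leq; apply/andP; split.
  apply/leq_sizeP=> j le_j; rewrite coef_dmul (nth_default _ (ltnW le_j)) deltaK0 addr0.
  by case: j le_j => //= j le_j; rewrite nth_default ?sigmaK0.
rewrite ltnNge; apply/negP => /leq_sizeP/(_ _ (leqnn _))/eqP.
rewrite coef_dmul (nth_default _ (leqnn _)) deltaK0 addr0 gtn_eqF //.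
by rewrite sigmaK_eq0 -lead_coefE lead_coef_eq0 (negPf nz_M).
Qed.

Lemma lead_coef_dmul M : M != 0 -> lead_coef (dm M) = sgK (lead_coef M).
Proof.
move=> nz_M; rewrite [LHS]lead_coefE size_dmul //= coef_dmul.
rewrite (nth_default _ (leqnn _)) deltaK0 addr0.
by rewrite gtn_eqF ?size_poly_gt0.
Qed.

Lemma size_iter_dmul n M : M != 0 -> size (iter n dm M) = (n + size M)%N.
Proof.
move=> nz_M; elim: n => //= n IHn.
by rewrite size_dmul ?IHn // -size_poly_gt0 IHn ltn_addl ?size_poly_gt0.
Qed.

Lemma ore_mul_wide n P M : (size P <= n)%N -> omul P M = \sum_(i < n) P`_i *: iter i dm M.
Proof.
move=> le_n; rewrite /ore_mul (big_ord_widen n (fun i => P`_i *: iter i dm M)) //.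
rewrite big_mkcond; apply: eq_bigr => i _; case: ltnP => // le_i.
by rewrite nth_default ?scale0r.
Qed.

Lemma ore_mulB P1 P2 M : omul (P1 - P2) M = omul P1 M - omul P2 M.
Proof.
pose n := maxn (size P1) (size P2).
rewrite !(@ore_mul_wide n) ?leq_maxl ?leq_maxr //; last first.
  by rewrite (leq_trans (size_polyD _ _)) // size_polyN.
rewrite -sumrB; apply: eq_bigr => i _.
by rewrite coefB scalerBl.
Qed.

Lemma ore_mulZ f P M : omul (f *: P) M = f *: omul P M.
Proof.
rewrite (@ore_mul_wide (size P)) ?size_scale_leq // scaler_sumr.
by apply: eq_bigr => i _; rewrite coefZ scalerA.
Qed.

(** The instance of associativity that keeps cont(L) stable under left multiplication by the Ore
    variable; it rests on the commutation rule [dmulZ], term by term. *)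
Lemma dmul_ore_mul P M : dm (omul P M) = omul (dm P) M.
Proof.
pose n := size P.
have sz_dP : (size (dm P) <= n.+1)%N.
  have [-> | nz_P] := eqVneq P 0; first by rewrite dmul0 size_poly0.
  by rewrite size_dmul.
rewrite (ore_mul_wide _ sz_dP) /ore_mul -/n.
rewrite (big_morph dm dmulD dmul0).
under eq_bigr do rewrite dmulZ.
under [RHS]eq_bigr do rewrite coef_dmul scalerDl.
(* On the right the sigma sum is shifted by one and has a zero first term, while the delta sum has a
   zero last term. *)
rewrite !big_split /= [X in _ = X + _]big_ord_recl [X in _ = _ + X]big_ord_recr /=.
by rewrite scale0r add0r (nth_default _ (leqnn _)) deltaK0 scale0r addr0.
Qed.

(** Orders add: the term of the leading coefficient of P has strictly larger order than all
    others. *)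
Lemma size_ore_mul P M : P != 0 -> M != 0 -> size (omul P M) = (size P + size M).-1.
Proof.
move=> nz_P nz_M; rewrite /ore_mul.
have [n Dn] : exists n, size P = n.+1.
  by exists (size P).-1; rewrite (ltn_predK (m := 0)) ?size_poly_gt0.
have nz_Pn : P`_n != 0 by rewrite -lead_coef_eq0 lead_coefE Dn in nz_P.
have sz_M : (0 < size M)%N by rewrite size_poly_gt0.
rewrite Dn big_ord_recr /= addrC size_polyDl ?size_scale ?size_iter_dmul //.
apply: leq_ltn_trans (size_sum _ _ _) _.
have -> : (n + size M = (n + (size M).-1).+1)%N by lia.
rewrite ltnS; apply/bigmax_leqP=> i _.
apply: leq_trans (size_scale_leq _ _) _; rewrite size_iter_dmul //.
by have := ltn_ord i; lia.
Qed.

(** * Operators over R[x] and the coefficient ideals *)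

Lemma coef_embedOp T i : (embedOp T)`_i = (T`_i)%:F.
Proof. exact: coef_map. Qed.

Lemma tofrac_inj : injective (@FracField.tofrac {poly R}).
Proof. by move=> p q /eqP; rewrite tofrac_eq => /eqP. Qed.

Lemma size_embedOp T : size (embedOp T) = size T.
Proof. by apply: size_map_inj_poly; [exact: tofrac_inj | exact: tofrac0]. Qed.

Lemma lead_coef_embedOp T : lead_coef (embedOp T) = (lead_coef T)%:F.
Proof. by rewrite !lead_coefE size_embedOp coef_embedOp. Qed.

Lemma embedOp_eq0 T : (embedOp T == 0) = (T == 0).
Proof. by rewrite -!size_poly_eq0 size_embedOp. Qed.

Definition dmulP T : {poly {poly R}} := 'X * map_poly sg T + map_poly d T.

Lemma embedOp_dmulP T : embedOp (dmulP T) = dm (embedOp T).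
Proof.
have sg0 : sg 0 = 0 by rewrite /sigmaP comp_poly0.
have d0 : d 0 = 0 by apply: (addrI (d 0)); rewrite -derivationD !addr0.
apply/polyP=> i; rewrite coef_embedOp coef_dmul !coef_embedOp deltaK_tofrac sigmaK_tofrac.
rewrite /dmulP coefD coefXM (coef_map_id0 _ _ d0) tofracD; congr (_ + _).
by case: i => [|i] /=; rewrite ?tofrac0 // (coef_map_id0 _ _ sg0).
Qed.

Lemma size_dmulP T : T != 0 -> size (dmulP T) = (size T).+1.
Proof.
by move=> nz_T; rewrite -size_embedOp embedOp_dmulP size_dmul ?size_embedOp ?embedOp_eq0.
Qed.

Lemma lead_coef_dmulP T : T != 0 -> lead_coef (dmulP T) = sg (lead_coef T).
Proof.
move=> nz_T; apply: tofrac_inj; rewrite -lead_coef_embedOp embedOp_dmulP.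
by rewrite lead_coef_dmul ?embedOp_eq0 // lead_coef_embedOp sigmaK_tofrac.
Qed.

Lemma inCont_dmulP L T : inCont g t d L T -> inCont g t d L (dmulP T).
Proof. by case=> P DT; exists (dm P); rewrite embedOp_dmulP DT dmul_ore_mul. Qed.

(** Multiply T on the left by the Ore variable until its order is k; each multiplication stays in
    cont(L) and applies sigma to the leading coefficient. *)
Lemma inI_lead_coef k L T : inCont g t d L T -> T != 0 -> (size T <= k.+1)%N ->
  inI g t d k L (iter (k.+1 - size T) sg (lead_coef T)).
Proof.
have [n] := ubnP (k.+1 - size T)%N; elim: n T => // n IHn T le_n cT nz_T sz_T.
move: sz_T; rewrite leq_eqVlt => /predU1P[sz_T | lt_T].
  by rewrite sz_T subnn; right; exists T; rewrite lead_coefE sz_T; do 2?split; rewrite ?sz_T.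
have -> : (k.+1 - size T = (k.+1 - (size T).+1).+1)%N by lia.
rewrite iterSr -lead_coef_dmulP // -size_dmulP //.
apply: IHn; rewrite -?size_poly_gt0 ?size_dmulP //; first by lia.
exact: inCont_dmulP.
Qed.

Lemma inI_mull k L a p : inI g t d k L p -> inI g t d k L (a * p).
Proof.
case=> [->|[T [[[P DT] sz_T] ->]]]; first by left; rewrite mulr0.
right; exists (a *: T); rewrite coefZ; split=> //; split.
  exists (a%:F *: P); rewrite ore_mulZ -DT.
  by apply/polyP=> i; rewrite coef_embedOp !coefZ coef_embedOp tofracM.
exact: leq_trans (size_scale_leq _ _) sz_T.
Qed.

Lemma inI_sub k L p q : inI g t d k L p -> inI g t d k L q -> inI g t d k L (p - q).
Proof.
(* The separate case r = 0 is absorbed by the zero operator. *)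
have toT r : inI g t d k L r -> exists T, inM g t d k L T /\ r = T`_k.
  case=> [->|//]; exists 0; rewrite coef0; do 2?split; rewrite ?size_poly0 //.
  exists 0; rewrite /ore_mul size_poly0 big_ord0.
  by apply/polyP=> i; rewrite coef_embedOp !coef0 tofrac0.
move=> /toT[T1 [[[P1 D1] sz1] ->]] /toT[T2 [[[P2 D2] sz2] ->]].
right; exists (T1 - T2); rewrite coefB; split=> //; split.
  exists (P1 - P2); rewrite ore_mulB -D1 -D2.
  by apply/polyP=> i; rewrite coef_embedOp !coefB !coef_embedOp tofracB.
by rewrite (leq_trans (size_polyD _ _)) // size_polyN geq_max sz1 sz2.
Qed.

Lemma iter_sigmaPK n r p : iter (n + r) sgi (iter r sg p) = iter n sgi p.
Proof.
rewrite iterD; congr iter.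
by elim: r => // r IHr; rewrite iterSr [iter r.+1 sg p]iterS sigmaPK.
Qed.

Lemma size_iter_sigmaP n p : size (iter n sg p) = size p.
Proof. by elim: n => //= n <-; rewrite size_sigmaP. Qed.

Lemma tofrac_eq_divM p a b q : b != 0 ->
  p%:F = a%:F / b%:F * q%:F :> K <-> b * p = a * q.
Proof.
move=> nz_b; have nz_bF := tofrac_neq0 nz_b; rewrite mulrAC; split=> [Dp | Dbp].
  by apply/eqP; rewrite -tofrac_eq !tofracM Dp mulrCA mulfV ?mulr1.
by rewrite -tofracM -Dbp tofracM mulrC mulKf.
Qed.

Lemma inI_minimal_dvd k L p q :
    inI g t d k L p -> inI g t d k L q -> p != 0 ->
    (forall r, inI g t d k L r -> r != 0 -> (size p <= size r)%N) ->
  exists (c : R) r, c != 0 /\ c%:P * q = r * p.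
Proof.
(* Pseudo-division over R scales the dividend by this power of [lead_coef p]; the remainder is in
   I_k with smaller degree than p, hence zero. *)
move=> Ip Iq nz_p min_p; exists (lead_coef p ^+ scalp q p), (q %/ p).
split; first by rewrite expf_neq0 ?lead_coef_eq0.
have Drem := divp_eq q p; rewrite -mul_polyC in Drem.
suff rem0 : q %% p = 0 by rewrite Drem rem0 addr0.
apply/eqP/negPn/negP => nz_rem; suff /min_p/(_ nz_rem) : inI g t d k L (q %% p).
  by rewrite leqNgt ltn_modp nz_p.
have -> : q %% p = (lead_coef p ^+ scalp q p)%:P * q - (q %/ p) * p.
  by rewrite Drem addrAC subrr add0r.
by apply: inI_sub; apply: inI_mull.
Qed.

(** Additivity of orders fixes the order of the left factor P, which is the order at which
    removability will be witnessed. *)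
Lemma inCont_quotient L T : inCont g t d L T -> L != 0 -> T != 0 ->
  exists P, [/\ embedOp T = omul P (embedOp L), (size L <= size T)%N &
                size P = (size T - size L).+1].
Proof.
case=> P DT nz_L nz_T; exists P.
have nz_P : P != 0.
  apply: contraNneq nz_T => P0; rewrite -embedOp_eq0 DT P0.
  by rewrite /ore_mul size_poly0 big_ord0.
have := size_ore_mul nz_P (_ : embedOp L != 0); rewrite embedOp_eq0 => /(_ nz_L).
rewrite -DT !size_embedOp => sz_T; move: nz_P nz_L; rewrite -!size_poly_gt0.
by split=> //; lia.
Qed.

End OreOperators.

(** * Minimal degree in the coefficient ideal forces desingularization *)

Theorem mainTheorem2 (R : idomainType) (g t : R) (d : {poly R} -> {poly R})
    (L : {poly {poly R}}) (k : nat) (s : {poly R}) :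
  PID R -> g \is a GRing.unit -> sigma_derivation g t d ->
  (1 < size L)%N ->
  (exists T, inM g t d k L T /\ desingularized g t d L T) ->
  inI g t d k L s -> s != 0 ->
  (forall s', inI g t d k L s' -> s' != 0 -> (size s <= size s')%N) ->
  forall S, inM g t d k L S -> lead_coef S = s -> desingularized g t d L S.
Proof.
move=> pidR Ug der_d L_gt1 [T [[_ sz_T] [nz_T [cT [m [c [p [e]]]]]]]].
case=> DL [irr_p [cop_p [a [b [kk [nz_b [DT nonrem]]]]]]] _ nz_s min_s S [cS sz_S] DS.
have prim_p i : prime_elt (p i) by case: (irr_p i) => /(irredR_prime pidR).
have nz_L : L != 0 by rewrite -size_poly_gt0 ltnW.
have nz_S : S != 0 by rewrite -lead_coef_eq0 DS.
have nz_c : c != 0.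
  by apply: contraNneq nz_L => c0; rewrite -lead_coef_eq0 DL c0 mul0r.
have nz_prod := prod_prime_exp_neq0 _ prim_p.
(* The integer exponent of sigma is nonpositive and the truncated difference is exact, so only
   iterates of the inverse of sigma occur. *)
have exponent (U : {poly {poly R}}) : (size L <= size U)%N ->
    (size L).-1%:Z - (size U).-1%:Z = - (size U - size L)%N%:Z.
  by move: L_gt1; move: (size L) (size U) => u v; lia.
have [PT [_ leT _]] := inCont_quotient Ug der_d cT nz_L nz_T.
have [P [DP leS szP]] := inCont_quotient Ug der_d cS nz_L nz_S.
set n := (size S - size L)%N in szP.
(* [s'] and [t'] are the leading coefficients of S and T shifted back to the order of L. *)
pose s' := iter n (sigmaPinv g t) s.
pose t' := iter (size T - size L) (sigmaPinv g t) (lead_coef T).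
have nz_s' : s' != 0 by rewrite iter_sigmaPinv_eq0.
have nz_t' : t' != 0 by rewrite iter_sigmaPinv_eq0 ?lead_coef_eq0.
(* The relation c t = q s in I_k, transported by sigma^(r - k), k - r = k.+1 - size L. *)
have [c1 [q [nz_c1 Dt']]] : exists (c1 : R) q, c1 != 0 /\ c1%:P * t' = q * s'.
  have := inI_lead_coef Ug der_d cT nz_T sz_T; have := inI_lead_coef Ug der_d cS nz_S sz_S.
  rewrite DS; set sk := iter _ _ s; set tk := iter _ _ _ => Isk Itk.
  have [||c1 [q [nz_c1 Dq]]] := inI_minimal_dvd Isk Itk.
  - by rewrite -size_poly_gt0 size_iter_sigmaP ?size_poly_gt0.
  (* sigma preserves degrees, so the shifted element [sk] is still of minimal degree. *)
  - by move=> r Ir nz_r; rewrite size_iter_sigmaP ?min_s.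
  exists c1, (iter (k.+1 - size L) (sigmaPinv g t) q); split=> //.
  have := congr1 (iter (k.+1 - size L) (sigmaPinv g t)) Dq.
  rewrite !iter_sigmaPinvM iter_sigmaPinvC.
  (* Of these inverse shifts, [k.+1 - size T] undo those that raised T to order k; the others
     produce [t']. *)
  have -> : iter (k.+1 - size L) (sigmaPinv g t) tk = t'.
    have -> : (k.+1 - size L = (size T - size L) + (k.+1 - size T))%N.
      by rewrite addnC addnBA // subnK.
    exact: (iter_sigmaPK t Ug).
  have -> // : iter (k.+1 - size L) (sigmaPinv g t) sk = s'.
  have -> : (k.+1 - size L = n + (k.+1 - size S))%N.
    by rewrite addnC addnBA // subnK.
  exact: (iter_sigmaPK t Ug).
rewrite exponent // sigmaZK_opp_tofrac // in DT.
have nz_bkk : b%:P * \prod_(i < m) p i ^+ kk i != 0 by rewrite mulf_neq0 ?polyC_eq0.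
have {}DT := iffLR (tofrac_eq_divM _ _ _ nz_bkk) DT.
rewrite -/t' in DT.
have nz_a : a != 0.
  apply: contraNneq nz_t' => a0; move/eqP: DT.
  by rewrite a0 mul0r mulf_eq0 (negPf nz_bkk).
have nz_C : c1 * a * c != 0 by rewrite !mulf_neq0.
(* Multiply the cleared equation [DT] for T by c1 and replace c1 t' by q s': this exhibits s' as a
   divisor of a constant times the prime powers of lc(L). *)
have DC : (c1 * a * c)%:P * \prod_(i < m) p i ^+ e i =
    \prod_(i < m) p i ^+ kk i * (b%:P * q) * s'.
  have -> : \prod_(i < m) p i ^+ kk i * (b%:P * q) * s' =
    b%:P * \prod_(i < m) p i ^+ kk i * (q * s') by ring.
  by rewrite -Dt' mulrCA DT DL !polyCM; ring.
have [u [h [Ds' le_h]]] := factor_prod_prime prim_p nz_C DC.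
have nz_u : u != 0 by apply: contraNneq nz_s' => u0; rewrite Ds' u0 mul0r.
have Dlc : lead_coef L = c%:P * (\prod_(i < m) p i ^+ (e i - h i)%N *
    \prod_(i < m) p i ^+ h i).
  rewrite -big_split DL /=; congr (_ * _).
  by apply: eq_bigr => i _; rewrite -exprD subnK.
have le_e i : (e i <= kk i + h i)%N.
  rewrite leqNgt; apply/negP => lt_i; apply: (nonrem i (e i - h i)%N).
    by rewrite ltn_subRL addnC.
  exists n; split.
    exists (c%:P * \prod_(j < m | j != i) p j ^+ (e j - h j)%N * \prod_(i < m) p i ^+ h i).
    by rewrite Dlc [X in _ * (X * _) = _](bigD1 i) //=; ring.
  (* With w = u and this v, the denominator v p_i^(e_i - h_i) is c times all p_j^(e_j - h_j), so
     dividing lc(L) by it leaves the product of the p_j^(h_j), and u times that is s'. *)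
  exists P, u%:P, (c%:P * \prod_(j < m | j != i) p j ^+ (e j - h j)%N).
  have Dv : c%:P * \prod_(j < m | j != i) p j ^+ (e j - h j)%N * p i ^+ (e i - h i) =
      c%:P * \prod_(j < m) p j ^+ (e j - h j)%N.
    by rewrite [in RHS](bigD1 i) //=; ring.
  have nz_v : c%:P * \prod_(j < m) p j ^+ (e j - h j)%N != 0 by rewrite mulf_neq0 ?polyC_eq0.
  split=> //; split; last split; last split.
  - by move: nz_v; rewrite -Dv mulf_eq0 negb_or => /andP[].
  - exact: (coprimeR_prime_exp (prim_p i) (prime_eltN_polyC (prim_p i) nz_u)).
  - by move=> j; exists S`_j; rewrite -DP coef_embedOp.
  rewrite -DP lead_coef_embedOp sigmaZK_opp_tofrac // DS -/s' Dv.
  by apply/tofrac_eq_divM => //; rewrite Ds' Dlc; ring.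
have De i : e i = (kk i + h i)%N.
  by apply: (prod_prime_exp_eq prim_p nz_C _ le_e); rewrite DC Ds'.
split=> //; split=> //; exists m, c, p, e; do 3![split=> //].
(* Since e_i = k_i + h_i, dividing lc(L) by c times the p_i^(k_i) leaves the p_i^(h_i), and the
   factor u gives s'. The exponents [kk], with their non-removability, are those of T. *)
exists u, c, kk; split=> //; split=> //.
rewrite exponent // sigmaZK_opp_tofrac // DS -/s'.
apply/tofrac_eq_divM; first by rewrite mulf_neq0 ?polyC_eq0.
rewrite Ds' DL; have -> : \prod_(i < m) p i ^+ e i =
    \prod_(i < m) p i ^+ kk i * \prod_(i < m) p i ^+ h i.
  by rewrite -big_split; apply: eq_bigr => i _; rewrite De exprD.
by ring.
Qed.
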